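(* (1) Given $\mathbf{a},\mathbf{b}\in B^{4n}$, there exists $(\mathbf{U},q_0)\in{\rm Sp}(n){\rm Sp}(1)$ such that $$\varphi_{\mathbf{a}}\circ\varphi_{\mathbf{b}}=(\mathbf{U},q_0)\circ\varphi_{\mathbf{c}}\qquad\text{with}\qquad\mathbf{c}=\varphi_{\mathbf{b}}(\mathbf{a}).$$ (2) For $\mathbf{a}\in B^{4n}$ and $(\mathbf{U}_1,q_1)\in{\rm Sp}(n){\rm Sp}(1)$, there exist $\mathbf{b}\in B^{4n}$ and $(\mathbf{U}_2,q_2)\in{\rm Sp}(n){\rm Sp}(1)$ such that $$\varphi_{\mathbf{a}}\circ(\mathbf{U}_1,q_1)=(\mathbf{U}_2,q_2)\circ\varphi_{\mathbf{b}}.$$ (3) $G=\{(\mathbf{U},q_0)\circ\varphi_{\mathbf{a}}:(\mathbf{U},q_0)\in{\rm Sp}(n){\rm Sp}(1),\ \mathbf{a}\in B^{4n}\}$ is a group (under composition of maps of $B^{4n}$).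
   Context: $\mathbb{H}$ is the quaternion algebra, $n\ge1$, $\mathbb{H}^n$ is the space of quaternionic $(n\times1)$ column vectors, $\mathbf{a}^*=\bar{\mathbf{a}}^t$, $|\mathbf{q}|^2=\mathbf{q}^*\mathbf{q}$, $B^{4n}=\{\mathbf{q}\in\mathbb{H}^n:|\mathbf{q}|<1\}$. For $\mathbf{a}\in B^{4n}$ put $s_{\mathbf{a}}=(1-|\mathbf{a}|^2)^{1/2}$, $\mathbf{A}=(1-s_{\mathbf{a}})|\mathbf{a}|^{-2}\mathbf{a}\mathbf{a}^*+s_{\mathbf{a}}I_n$ (with $\mathbf{A}=I_n$ if $\mathbf{a}=\mathbf{0}$), and $\varphi_{\mathbf{a}}(\mathbf{q})=(\mathbf{a}-\mathbf{A}\mathbf{q})(1-\mathbf{a}^*\mathbf{q})^{-1}$ for $\mathbf{q}\in B^{4n}$. ${\rm Sp}(n)$ is the group of quaternionic $n\times n$ matrices $\mathbf{U}$ with $\mathbf{U}\mathbf{U}^*=I_n$, ${\rm Sp}(1)$ the group of unit quaternions. For $\mathbf{U}\in{\rm Sp}(n)$, $q_0\in{\rm Sp}(1)$, $(\mathbf{U},q_0)\in{\rm Sp}(n){\rm Sp}(1)$ denotes the real linear map $\mathbb{H}^n\to\mathbb{H}^n$, $\mathbf{q}\mapsto\mathbf{U}\mathbf{q}q_0^*$. *)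

(* Defs.v *)
From HB Require Import structures.
From mathcomp Require Import all_boot all_order all_algebra.
From mathcomp Require Import classical_sets reals.
From mathcomp Require Import ring lra.

Set Implicit Arguments.
Unset Strict Implicit.
Unset Printing Implicit Defensive.

Import Order.TTheory GRing.Theory Num.Theory.
Local Open Scope ring_scope.

(* [Quat a b c d] is the quaternion a + b i + c j + d k. *)
Record quat (R : realType) := Quat { qre : R; qi : R; qj : R; qk : R }.

Section QuaternionAlgebra.
Variable R : realType.
Implicit Types x y z : quat R.

Definition quat_to_tuple x : R * R * R * R := (qre x, qi x, qj x, qk x).
Definition tuple_to_quat (t : R * R * R * R) : quat R :=
  let: (a, b, c, d) := t in Quat a b c d.
Lemma quat_to_tupleK : cancel quat_to_tuple tuple_to_quat.
Proof. by case. Qed.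
HB.instance Definition _ := Choice.copy (quat R) (can_type quat_to_tupleK).

Definition addq x y :=
  Quat (qre x + qre y) (qi x + qi y) (qj x + qj y) (qk x + qk y).
Definition oppq x := Quat (- qre x) (- qi x) (- qj x) (- qk x).
Definition zeroq : quat R := Quat 0 0 0 0.

Lemma addqA : associative addq.
Proof. by move=> [????] [????] [????]; rewrite /addq /= !addrA. Qed.
Lemma addqC : commutative addq.
Proof. by move=> [????] [????]; congr Quat; rewrite /= addrC. Qed.
Lemma add0q : left_id zeroq addq.
Proof. by move=> [????]; rewrite /addq /= !add0r. Qed.
Lemma addNq : left_inverse zeroq oppq addq.
Proof. by move=> [????]; rewrite /addq /= !addNr. Qed.
HB.instance Definition _ :=
  GRing.isZmodule.Build (quat R) addqA addqC add0q addNq.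

Definition oneq : quat R := Quat 1 0 0 0.
(* The bilinear product with i^2 = j^2 = k^2 = ijk = -1; see [quat_ij]. *)
Definition mulq x y :=
  let: Quat a b c d := x in let: Quat a' b' c' d' := y in
  Quat (a * a' - b * b' - c * c' - d * d')
       (a * b' + b * a' + c * d' - d * c')
       (a * c' - b * d' + c * a' + d * b')
       (a * d' + b * c' - c * b' + d * a').

Lemma mulqA : associative mulq.
Proof. by move=> [????] [????] [????]; congr Quat; ring. Qed.
Lemma mul1q : left_id oneq mulq.
Proof. by move=> [????]; congr Quat; ring. Qed.
Lemma mulq1 : right_id oneq mulq.
Proof. by move=> [????]; congr Quat; ring. Qed.
Lemma mulqDl : left_distributive mulq addq.
Proof. by move=> [????] [????] [????]; congr Quat => /=; ring. Qed.
Lemma mulqDr : right_distributive mulq addq.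
Proof. by move=> [????] [????] [????]; congr Quat => /=; ring. Qed.
Lemma oneq_neq0 : oneq != zeroq.
Proof. by apply/eqP => -[] /eqP; rewrite oner_eq0. Qed.
HB.instance Definition _ :=
  GRing.Zmodule_isNzRing.Build (quat R) mulqA mul1q mulq1 mulqDl mulqDr oneq_neq0.

Definition conjq x := Quat (qre x) (- qi x) (- qj x) (- qk x).
Definition normsqq x : R := qre x ^+ 2 + qi x ^+ 2 + qj x ^+ 2 + qk x ^+ 2.
Definition normq x : R := Num.sqrt (normsqq x).
Definition realq (r : R) : quat R := Quat r 0 0 0.

Lemma normsqq_eq0 x : (normsqq x == 0) = (x == 0).
Proof.
case: x => a b c d; rewrite /normsqq /=; apply/eqP/eqP; last first.
  by case=> -> -> -> ->; rewrite !expr0n /= !addr0.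
have := (sqr_ge0 a, sqr_ge0 b, sqr_ge0 c, sqr_ge0 d).
case=> [[[a0 b0] c0] d0] s0.
have z (t : R) : t ^+ 2 = 0 -> t = 0 by move/eqP; rewrite sqrf_eq0 => /eqP.
by congr Quat; apply: z; lra.
Qed.

Definition invq x := realq (normsqq x)^-1 * conjq x.

Lemma mulVq : {in [pred x | x != 0], left_inverse 1 invq *%R}.
Proof.
move=> x; rewrite inE -normsqq_eq0; case: x => a b c d n0.
rewrite /invq; move: n0; rewrite /normsqq /= => n0.
by congr Quat => /=; field.
Qed.
Lemma mulqV : {in [pred x | x != 0], right_inverse 1 invq *%R}.
Proof.
move=> x; rewrite inE -normsqq_eq0; case: x => a b c d n0.
rewrite /invq; move: n0; rewrite /normsqq /= => n0.
by congr Quat => /=; field.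
Qed.
Lemma unitqP x y : y * x = 1 /\ x * y = 1 -> x != 0.
Proof.
by case=> yx _; apply/eqP => x0; move/eqP: yx; rewrite x0 mulr0 eq_sym oner_eq0.
Qed.
Lemma invq0 : {in [predC [pred x | x != 0]], invq =1 id}.
Proof.
move=> x; rewrite !inE negbK => /eqP ->.
by rewrite /invq; congr Quat => /=; ring.
Qed.
HB.instance Definition _ :=
  GRing.NzRing_hasMulInverse.Build (quat R) mulVq mulqV unitqP invq0.

Lemma quat_ij (i := Quat 0 1 0 0 : quat R) (j := Quat 0 0 1 0 : quat R)
    (k := Quat 0 0 0 1 : quat R) :
  [/\ i * i = -1, j * j = -1, k * k = -1 & i * j * k = -1].
Proof. by split; congr Quat => /=; ring. Qed.

Lemma conjqM x : conjq x * x = realq (normsqq x).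
Proof. by case: x => a b c d; congr Quat => /=; rewrite /normsqq /=; ring. Qed.

End QuaternionAlgebra.

Section BallMaps.
Variables (R : realType) (n : nat).
Local Notation H := (quat R).
Implicit Types (a q : 'cV[H]_n) (U : 'M[H]_n).

Definition adjmx m p (M : 'M[H]_(m, p)) : 'M[H]_(p, m) := map_mx (@conjq R) M^T.

(* q^* q is a real 1 x 1 matrix, see [vnormsqE]; we read off its real part. *)
Definition vnormsq q : R := qre ((adjmx q *m q) ord0 ord0).
Definition vnorm q : R := Num.sqrt (vnormsq q).

Lemma vnormsqE q : adjmx q *m q = (realq (vnormsq q))%:M.
Proof.
apply/matrixP => i j; rewrite !ord1 !mxE eqxx mulr1n /vnormsq !mxE.
apply: (big_rec (fun s : H => s = realq (qre s))) => // k s _ ->.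
by rewrite !mxE conjqM; congr Quat => /=; ring.
Qed.

Lemma vnormsq_sum q : vnormsq q = \sum_(i < n) normsqq (q i ord0).
Proof.
rewrite /vnormsq !mxE; apply: (big_rec2 (fun (s : H) t => qre s = t)) => //.
by move=> k s t _ <-; rewrite !mxE conjqM.
Qed.

Definition qball : set 'cV[H]_n := [set q | vnorm q < 1].

Definition ball_s a : R := Num.sqrt (1 - vnorm a ^+ 2).

Definition ball_mx a : 'M[H]_n :=
  if a == 0 then 1%:M
  else realq ((1 - ball_s a) * (vnorm a ^+ 2)^-1) *: (a *m adjmx a)
       + (realq (ball_s a))%:M.

(* Right multiplication of a column v by the quaternion x is [v *m x%:M]. *)
Definition phi a q : 'cV[H]_n :=
  (a - ball_mx a *m q) *m ((1 - (adjmx a *m q) ord0 ord0)^-1)%:M.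

Definition Sp : set 'M[H]_n := [set U | U *m adjmx U = 1%:M].

Definition unitq : set H := [set q0 | normq q0 = 1].

Definition spact U (q0 : H) q : 'cV[H]_n := U *m q *m (conjq q0)%:M.

Definition Gball : set ('cV[H]_n -> 'cV[H]_n) :=
  [set f | exists (U : 'M[H]_n) (q0 : H) (a : 'cV[H]_n),
     [/\ Sp U, unitq q0, qball a & f = spact U q0 \o phi a]].

End BallMaps.

Arguments qball : clear implicits.
Arguments Sp : clear implicits.
Arguments unitq : clear implicits.
Arguments Gball : clear implicits.

(* The restrictions to B of the maps in G form a group of self-maps of B under
   composition. Maps are total functions on T, so two of them are identified
   when they agree on B. *)
Definition map_group_on (T : Type) (B : set T) (G : set (T -> T)) : Prop :=
  [/\ forall f, G f -> forall x, B x -> B (f x),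
      forall f g, G f -> G g -> exists2 h, G h & {in B, f \o g =1 h},
      exists2 e, G e & {in B, e =1 id}
    & forall f, G f -> exists g,
        [/\ G g, {in B, g \o f =1 id} & {in B, f \o g =1 id}]].

(* Main.v *)
From HB Require Import structures.
Require Import Defs.
From mathcomp Require Import all_boot all_order all_algebra.
From mathcomp Require Import classical_sets reals.
From mathcomp Require Import ring lra.

(**
  In homogeneous coordinates [(q; 1)], the map [phi a] is the projective action
  of the matrix [M_a = [[-A, a], [-a^*, 1]]], which satisfies [M_a M_a = s_a^2 I]
  and [M_a^* J = J M_a] for [J = diag(I_n, -1)]; hence [M_a^* J M_a = s_a^2 J].
  So [phi a] is an involution of the ball.  For [c = phi b a], the product
  [T = M_a M_b M_c] multiplies [J] by a positive real and fixes the line of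
  [(0; 1)], so it is block diagonal and acts as an element of Sp(n)Sp(1).  For
  (2), the conjugate of [phi a] by [(U, q)] is [phi (U^* a q)].
*)

Set Implicit Arguments.
Unset Strict Implicit.
Unset Printing Implicit Defensive.

Import Order.TTheory GRing.Theory Num.Theory.
Local Open Scope ring_scope.

(** * Real scalars, conjugation and norm in the quaternions *)

Section Quaternions.
Variable R : realType.
Implicit Types (x y : quat R) (r s : R).

Lemma realqC r x : realq r * x = x * realq r.
Proof. by case: x => a b c d; congr Quat => /=; ring. Qed.

Lemma realqM r s : realq (r * s) = realq r * realq s.
Proof. by congr Quat => /=; ring. Qed.

Lemma realqD r s : realq (r + s) = realq r + realq s.
Proof. by congr Quat => /=; ring. Qed.

Lemma realq1 : realq 1 = 1 :> quat R.
Proof. by []. Qed.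

Lemma realq_inj : injective (@realq R).
Proof. by move=> r s []. Qed.

Lemma conjqB x y : conjq (x - y) = conjq x - conjq y.
Proof. by case: x y => [????] [????]; congr Quat => /=; ring. Qed.

HB.instance Definition _ := GRing.isZmodMorphism.Build _ _ (@conjq R) conjqB.

Lemma qreB x y : qre (x - y) = qre x - qre y. Proof. by []. Qed.
Lemma qiB x y : qi (x - y) = qi x - qi y. Proof. by []. Qed.
Lemma qjB x y : qj (x - y) = qj x - qj y. Proof. by []. Qed.
Lemma qkB x y : qk (x - y) = qk x - qk y. Proof. by []. Qed.
HB.instance Definition _ := GRing.isZmodMorphism.Build _ _ (@qre R) qreB.
HB.instance Definition _ := GRing.isZmodMorphism.Build _ _ (@qi R) qiB.
HB.instance Definition _ := GRing.isZmodMorphism.Build _ _ (@qj R) qjB.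
HB.instance Definition _ := GRing.isZmodMorphism.Build _ _ (@qk R) qkB.

Lemma conjq_mul x y : conjq (x * y) = conjq y * conjq x.
Proof. by case: x y => [????] [????]; congr Quat => /=; ring. Qed.

Lemma conjqK : involutive (@conjq R).
Proof. by case=> a b c d; congr Quat => /=; ring. Qed.

Lemma conjq_real r : conjq (realq r) = realq r.
Proof. by congr Quat => /=; ring. Qed.

Lemma conjq1 : conjq 1 = 1 :> quat R.
Proof. exact: conjq_real. Qed.

Lemma mulq_conj x : x * conjq x = realq (normsqq x).
Proof. by case: x => a b c d; congr Quat => /=; rewrite /normsqq /=; ring. Qed.

Lemma normsqq_ge0 x : 0 <= normsqq x.
Proof. by rewrite /normsqq !addr_ge0 ?sqr_ge0. Qed.

(** Euler's four-square identity. *)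
Lemma normsqqM x y : normsqq (x * y) = normsqq x * normsqq y.
Proof. by case: x y => [????] [????]; rewrite /normsqq /=; ring. Qed.

Lemma normsqq_real r : normsqq (realq r) = r ^+ 2.
Proof. by rewrite /normsqq /=; ring. Qed.

Lemma normsqq_conj x : normsqq (conjq x) = normsqq x.
Proof. by case: x => a b c d; rewrite /normsqq /=; ring. Qed.

Lemma quat_unitE x : (x \is a GRing.unit) = (x != 0).
Proof. by []. Qed.

Lemma unitqP x : unitq R x <-> normsqq x = 1.
Proof.
rewrite /unitq /mkset /Defs.normq; split=> [h|->]; last exact: sqrtr1.
by rewrite -[LHS]sqr_sqrtr ?normsqq_ge0// h expr1n.
Qed.

Lemma unitq_mulVq x : unitq R x -> conjq x * x = 1.
Proof. by move/unitqP=> h; rewrite conjqM h realq1. Qed.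

Lemma unitq_mulqV x : unitq R x -> x * conjq x = 1.
Proof. by move/unitqP=> h; rewrite mulq_conj h realq1. Qed.

Lemma unitq_conj x : unitq R x -> unitq R (conjq x).
Proof. by move/unitqP=> h; apply/unitqP; rewrite normsqq_conj. Qed.

Lemma unitq_mul x y : unitq R x -> unitq R y -> unitq R (x * y).
Proof.
move=> /unitqP hx /unitqP hy; apply/unitqP.
by rewrite normsqqM hx hy mulr1.
Qed.

End Quaternions.

(** * Quaternionic matrices: adjoints, and inverses through real matrices *)

Section QuaternionicMatrices.
Variable R : realType.
Local Notation H := (quat R).

(** Real quaternions are central, so for them right multiplication turns into left scaling; general
    quaternions must stay on the right. *)
Lemma mulmx_realq m n (r : R) (A : 'M[H]_(m, n)) :
  A *m (realq r)%:M = realq r *: A.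
Proof.
apply/matrixP => i j; rewrite !mxE (bigD1 j)//= mxE eqxx mulr1n big1 ?addr0.
  by rewrite realqC.
by move=> k kj; rewrite mxE (negbTE kj) mulr0n mulr0.
Qed.

Lemma scale_realq_mulmx m n p (r : R) (A : 'M[H]_(m, n)) (B : 'M[H]_(n, p)) :
  A *m (realq r *: B) = realq r *: (A *m B).
Proof. by rewrite -mulmx_realq mulmxA mulmx_realq. Qed.

Lemma adjmxM m n p (A : 'M[H]_(m, n)) (B : 'M[H]_(n, p)) :
  adjmx (A *m B) = adjmx B *m adjmx A.
Proof.
apply/matrixP => i j; rewrite !mxE raddf_sum; apply: eq_bigr => k _.
by rewrite !mxE; exact: conjq_mul.
Qed.

Lemma adjmxB m n (A B : 'M[H]_(m, n)) : adjmx (A - B) = adjmx A - adjmx B.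
Proof. by apply/matrixP => i j; rewrite !mxE; exact: conjqB. Qed.

HB.instance Definition _ m n :=
  GRing.isZmodMorphism.Build _ _ (@adjmx R m n) (@adjmxB m n).

Lemma adjmx0 m n : adjmx 0 = 0 :> 'M[H]_(m, n).
Proof. exact: raddf0. Qed.

Lemma adjmxK m n (A : 'M[H]_(m, n)) : adjmx (adjmx A) = A.
Proof. by apply/matrixP => i j; rewrite !mxE conjqK. Qed.

Lemma adjmx_scalar n (x : H) : adjmx (x%:M : 'M_n) = (conjq x)%:M.
Proof.
apply/matrixP => i j; rewrite !mxE eq_sym.
by case: (i == j); rewrite ?mulr1n // !mulr0n raddf0.
Qed.

Lemma adjmxZ_real m n (r : R) (A : 'M[H]_(m, n)) :
  adjmx (realq r *: A) = realq r *: adjmx A.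
Proof.
by apply/matrixP => i j; rewrite !mxE conjq_mul conjq_real realqC.
Qed.

Lemma adjmx_block m1 m2 n1 n2 (A : 'M[H]_(m1, n1)) (B : 'M[H]_(m1, n2))
    (C : 'M[H]_(m2, n1)) (D : 'M[H]_(m2, n2)) :
  adjmx (block_mx A B C D)
    = block_mx (adjmx A) (adjmx C) (adjmx B) (adjmx D).
Proof. by rewrite /adjmx tr_block_mx map_block_mx. Qed.

(* The real matrix of [v |-> M v], a quaternionic vector being the stack of its
   four real components. *)
Definition real_mx n (M : 'M[H]_n) : 'M[R]_((n + n) + (n + n)) :=
  let A := map_mx (@qre R) M in let B := map_mx (@qi R) M in
  let C := map_mx (@qj R) M in let D := map_mx (@qk R) M in
  block_mx (block_mx A (- B) B A) (block_mx (- C) (- D) (- D) C)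
           (block_mx C D D (- C)) (block_mx A (- B) B A).

(** Each of the sixteen blocks is, up to sign, one component of the Hamilton product summed over the
    inner index. *)
Lemma real_mxM n (M N : 'M[H]_n) : real_mx (M *m N) = real_mx M *m real_mx N.
Proof.
rewrite /real_mx !mulmx_block !add_block_mx.
by congr (block_mx (block_mx _ _ _ _) (block_mx _ _ _ _) (block_mx _ _ _ _)
           (block_mx _ _ _ _)); apply/matrixP => i j;
  rewrite !mxE raddf_sum /= -?sumrN -!big_split /=; apply: eq_bigr => k _;
  rewrite !mxE; case: (M i k) (N k j) => [????] [????] /=; ring.
Qed.

Lemma real_mx_inj n : injective (@real_mx n).
Proof.
move=> M N /eq_block_mx[/eq_block_mx[A _ B _] _ /eq_block_mx[C D _ _] _].
apply/matrixP => i j.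
move/matrixP/(_ i j): A; move/matrixP/(_ i j): B.
move/matrixP/(_ i j): C; move/matrixP/(_ i j): D.
by rewrite !mxE; case: (M i j) (N i j) => [????] [????] /= -> -> -> ->.
Qed.

Lemma real_mx1 n : real_mx 1%:M = 1%:M :> 'M_((n + n) + (n + n)).
Proof.
have E f : f 1 = 1 -> f 0 = 0 -> map_mx f (1%:M : 'M[H]_n) = 1%:M :> 'M[R]_n.
  by move=> f1 f0; apply/matrixP => i j; rewrite !mxE; case: (i == j).
have Z f : f 1 = 0 -> f 0 = 0 -> map_mx f (1%:M : 'M[H]_n) = 0 :> 'M[R]_n.
  by move=> f1 f0; apply/matrixP => i j; rewrite !mxE; case: (i == j).
by rewrite /real_mx E// !Z// oppr0 block_mx0 -!scalar_mx_block.
Qed.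

(** Over commutative entries this is a determinant argument; the injective, unital and
    multiplicative map [real_mx] transports it to quaternions. It turns $UU^*=I$ into $U^*U=I$ and
    back. *)
Lemma quat_mulmx1C n (A B : 'M[H]_n) : A *m B = 1%:M -> B *m A = 1%:M.
Proof.
move=> AB; apply: real_mx_inj.
by rewrite real_mxM real_mx1; apply: mulmx1C; rewrite -real_mxM AB real_mx1.
Qed.


Lemma adjmx_col m1 m2 n (A : 'M[H]_(m1, n)) (B : 'M[H]_(m2, n)) :
  adjmx (col_mx A B) = row_mx (adjmx A) (adjmx B).
Proof. by rewrite /adjmx tr_col_mx map_row_mx. Qed.

End QuaternionicMatrices.

(** * Norms of vectors and the matrix [ball_mx] *)

Section BallMaps.
Variables (R : realType) (n : nat).
Local Notation H := (quat R).
Implicit Types (a b p q : 'cV[H]_n) (U V : 'M[H]_n) (x y : H).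

Lemma vnormsq_ge0 q : 0 <= vnormsq q.
Proof. by rewrite vnormsq_sum sumr_ge0// => i _; exact: normsqq_ge0. Qed.

Lemma sqr_vnorm q : vnorm q ^+ 2 = vnormsq q.
Proof. by rewrite sqr_sqrtr// vnormsq_ge0. Qed.

Lemma qballP q : qball R n q <-> vnormsq q < 1.
Proof.
rewrite /qball /mkset -sqr_vnorm.
by rewrite -[X in _ <-> _ < X](expr1n _ 2) ltr_pXn2r// nnegrE ?sqrtr_ge0.
Qed.

Lemma vnormsq0 : vnormsq (0 : 'cV[H]_n) = 0.
Proof. by rewrite /vnormsq mulmx0 mxE. Qed.

Lemma qball0 : qball R n 0.
Proof. by apply/qballP; rewrite vnormsq0. Qed.

Lemma vnormsq_eq0 q : (vnormsq q == 0) = (q == 0).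
Proof.
apply/eqP/eqP => [|->]; last exact: vnormsq0.
rewrite vnormsq_sum => /eqP.
rewrite psumr_eq0; last by move=> i _; exact: normsqq_ge0.
move=> /allP h; apply/matrixP => i j; rewrite ord1 mxE.
by apply/eqP; rewrite -normsqq_eq0; exact: (h i (mem_index_enum i)).
Qed.

Lemma sqr_ball_s a : qball R n a -> ball_s a ^+ 2 = 1 - vnormsq a.
Proof.
by move/qballP=> h; rewrite /ball_s sqr_sqrtr sqr_vnorm// subr_ge0 ltW.
Qed.

Lemma ball_s_gt0 a : qball R n a -> 0 < ball_s a.
Proof. by move/qballP=> h; rewrite sqrtr_gt0 sqr_vnorm subr_gt0. Qed.

(* Since [1 - s_a^2 = |a|^2], the coefficient [(1 - s_a) / |a|^2] is
   [1 / (1 + s_a)], which also makes sense at [a = 0]. *)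
Lemma ball_mxE a : qball R n a ->
  ball_mx a = realq (1 + ball_s a)^-1 *: (a *m adjmx a) + (realq (ball_s a))%:M.
Proof.
move=> ha; have s0 := ball_s_gt0 ha; have s2 := sqr_ball_s ha.
rewrite /ball_mx; case: eqP => [a0|/eqP a0].
  have -> : ball_s a = 1 by rewrite /ball_s sqr_vnorm a0 vnormsq0 subr0 sqrtr1.
  by rewrite {1}a0 mul0mx scaler0 add0r.
rewrite sqr_vnorm; congr (realq _ *: _ + _).
have N0 : vnormsq a != 0 by rewrite vnormsq_eq0.
have N : vnormsq a = 1 - ball_s a ^+ 2 by rewrite s2; ring.
have s1 : 1 - ball_s a ^+ 2 != 0 by rewrite -N.
by rewrite N; field; rewrite s1/=; lra.
Qed.

Lemma adjmx_ball_mx a : qball R n a -> adjmx (ball_mx a) = ball_mx a.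
Proof.
move=> ha; rewrite ball_mxE// raddfD /= adjmxZ_real adjmxM adjmxK.
by rewrite adjmx_scalar conjq_real.
Qed.

(** With $s$ for [ball_s a], $|a|^2=(1-s)(1+s)$, so the two terms of [ball_mxE] multiply $a$ by
    $1-s$ and $s$. *)
Lemma ball_mx_self a : qball R n a -> ball_mx a *m a = a.
Proof.
move=> ha; have s0 := ball_s_gt0 ha; have s2 := sqr_ball_s ha.
rewrite ball_mxE// mulmxDl -scalemxAl -mulmxA vnormsqE mulmx_realq scalerA.
rewrite mul_scalar_mx -scalerDl -realqM -realqD.
have -> : vnormsq a = 1 - ball_s a ^+ 2 by rewrite s2; ring.
have -> : (1 + ball_s a)^-1 * (1 - ball_s a ^+ 2) + ball_s a = 1.
  by field; lra.
by rewrite realq1 scale1r.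
Qed.

(** Since $A$ fixes $a$, it fixes $aa^*$; the coefficients of $aa^*$ then add up to
    $(1+s)/(1+s)=1$. *)
Lemma sqr_ball_mx a : qball R n a ->
  ball_mx a *m ball_mx a = a *m adjmx a + (realq (ball_s a ^+ 2))%:M.
Proof.
move=> ha; have s0 := ball_s_gt0 ha.
rewrite {2}(ball_mxE ha) mulmxDr scale_realq_mulmx mulmxA ball_mx_self//.
rewrite mulmx_realq {1}(ball_mxE ha) scalerDr scalerA addrA -scalerDl.
rewrite -realqM -realqD scale_scalar_mx -realqM -expr2.
have -> : (1 + ball_s a)^-1 + ball_s a * (1 + ball_s a)^-1 = 1 by field; lra.
by rewrite realq1 scale1r.
Qed.

(** * Homogeneous coordinates, with quaternionic scalars acting on the right *)

Definition homog q : 'cV[H]_(n + 1) := col_mx q 1%:M.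

Definition homog_mx a : 'M[H]_(n + 1) :=
  block_mx (- ball_mx a) a (- adjmx a) 1%:M.

(** The Hermitian form of signature $(n,1)$; the ball consists of the points $q$ at which it is
    negative on [homog q]. *)
Definition lorentz_mx : 'M[H]_(n + 1) := block_mx 1%:M 0 0 (- 1%:M).
Local Notation J := lorentz_mx.

(** The off-diagonal blocks vanish by $Aa=a$ and its adjoint; the diagonal ones are $A^2-aa^*$ and
    $1-a^*a$, both equal to $s^2$. *)
Lemma homog_mx_sqr a : qball R n a ->
  homog_mx a *m homog_mx a = (realq (ball_s a ^+ 2))%:M.
Proof.
move=> ha; rewrite /homog_mx mulmx_block scalar_mx_block.
rewrite !mulNmx !mulmxN !mulmx1 !mul1mx opprK ball_mx_self// addNr.
rewrite sqr_ball_mx// addrAC subrr add0r.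
rewrite -[in adjmx a *m _](adjmx_ball_mx ha) -adjmxM ball_mx_self// opprK subrr.
congr block_mx; rewrite vnormsqE sqr_ball_s// -realq1 -raddfN -raddfD /=.
by congr (_%:M); congr Quat => /=; ring.
Qed.

Lemma adj_homog_mx a : qball R n a -> adjmx (homog_mx a) *m J = J *m homog_mx a.
Proof.
move=> ha; rewrite /homog_mx /J adjmx_block !mulmx_block !raddfN /= adjmxK.
rewrite adjmx_ball_mx// adjmx_scalar conjq1.
by rewrite !mulNmx !mulmx0 !mulmx1 !mul0mx !mul1mx !(oppr0, opprK, addr0, add0r).
Qed.

Lemma homog_mx_form a : qball R n a ->
  adjmx (homog_mx a) *m J *m homog_mx a = realq (ball_s a ^+ 2) *: J.
Proof.
by move=> ha; rewrite adj_homog_mx// -mulmxA homog_mx_sqr// mulmx_realq.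
Qed.

Lemma lorentz_similM (r s : R) (S T : 'M[H]_(n + 1)) :
  adjmx S *m J *m S = realq r *: J -> adjmx T *m J *m T = realq s *: J ->
  adjmx (S *m T) *m J *m (S *m T) = realq (r * s) *: J.
Proof.
move=> hS hT; rewrite adjmxM -!mulmxA (mulmxA J) (mulmxA (adjmx S)).
rewrite (mulmxA (adjmx S)) hS -scalemxAl scale_realq_mulmx mulmxA hT.
by rewrite scalerA realqM.
Qed.

Lemma lorentz_form p x :
  adjmx (col_mx p x%:M) *m J *m col_mx p x%:M
    = (realq (vnormsq p - normsqq x))%:M.
Proof.
rewrite adjmx_col /J mul_row_block mul_row_col !mulmx0 !mulmxN !mulmx1.
rewrite addr0 add0r vnormsqE mulNmx adjmx_scalar -scalar_mxM conjqM -raddfB /=.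
by congr (_%:M); congr Quat => /=; ring.
Qed.

Lemma mul_homog_mx a q : homog_mx a *m homog q
  = col_mx (a - ball_mx a *m q) (1 - (adjmx a *m q) ord0 ord0)%:M.
Proof.
rewrite mul_block_col !mulmx1 !mulNmx addrC; congr col_mx.
by rewrite raddfB /= -mx11_scalar addrC.
Qed.

(** This is the form evaluated at [homog_mx a *m homog q]. Being free of division, it serves both to
    show that the denominator of [phi a] is nonzero and to bound the norm of [phi a q]. *)
Lemma homog_mx_form_homog a q : qball R n a ->
  vnormsq (a - ball_mx a *m q) - normsqq (1 - (adjmx a *m q) ord0 ord0)
    = ball_s a ^+ 2 * (vnormsq q - 1).
Proof.
move=> ha; apply: (@realq_inj R).
have := lorentz_form (a - ball_mx a *m q) (1 - (adjmx a *m q) ord0 ord0).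
rewrite -mul_homog_mx adjmxM -!mulmxA (mulmxA J) (mulmxA _ (J *m _)) (mulmxA _ J).
rewrite homog_mx_form// -scalemxAl scale_realq_mulmx mulmxA lorentz_form.
rewrite scale_scalar_mx => /matrixP/(_ ord0 ord0); rewrite !mxE /= !mulr1n => <-.
rewrite -realqM; congr (realq (_ * (_ - _))).
by rewrite /normsqq /=; ring.
Qed.

(** A zero denominator would leave a nonnegative squared norm on the left of [homog_mx_form_homog],
    against a negative right side. *)
Lemma phi_denom_neq0 a q : qball R n a -> qball R n q ->
  1 - (adjmx a *m q) ord0 ord0 != 0.
Proof.
move=> ha /qballP hq; apply/eqP => x0.
have := homog_mx_form_homog q ha; rewrite x0.
have -> : normsqq (0 : H) = 0 by apply/eqP; rewrite normsqq_eq0.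
have := vnormsq_ge0 (a - ball_mx a *m q).
have s0 : 0 < ball_s a ^+ 2 by rewrite exprn_gt0// ball_s_gt0.
have : 0 < ball_s a ^+ 2 * (1 - vnormsq q) by rewrite mulr_gt0// subr_gt0.
rewrite !mulrBr; lra.
Qed.

Lemma homog_phi a q : qball R n a -> qball R n q ->
  homog_mx a *m homog q
    = homog (phi a q) *m (1 - (adjmx a *m q) ord0 ord0)%:M.
Proof.
move=> ha hq; rewrite mul_homog_mx /homog mul_col_mx mul1mx; congr col_mx.
by rewrite /phi -mulmxA -scalar_mxM mulVr ?mulmx1// quat_unitE phi_denom_neq0.
Qed.

Lemma vnormsqM q x : vnormsq (q *m x%:M) = vnormsq q * normsqq x.
Proof.
apply: (@realq_inj R).
have := vnormsqE (q *m x%:M); rewrite adjmxM -mulmxA (mulmxA _ q) vnormsqE.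
rewrite adjmx_scalar -!scalar_mxM => /matrixP/(_ ord0 ord0).
by rewrite !mxE /= !mulr1n => <-; rewrite realqC mulrA conjqM -realqM mulrC.
Qed.

(** Dividing [homog_mx_form_homog] by the squared norm of the denominator gives
    $|\varphi_a(q)|^2-1<0$. *)
Lemma phi_qball a q : qball R n a -> qball R n q -> qball R n (phi a q).
Proof.
move=> ha hq; apply/qballP; have x0 := phi_denom_neq0 ha hq.
have := homog_mx_form_homog q ha.
have -> : a - ball_mx a *m q = phi a q *m (1 - (adjmx a *m q) ord0 ord0)%:M.
  by rewrite /phi -mulmxA -scalar_mxM mulVr ?mulmx1.
rewrite vnormsqM; move/qballP: hq => hq.
move: x0; set x := 1 - _; rewrite -normsqq_eq0 => x0.
have := normsqq_ge0 x; rewrite le_eqVlt eq_sym (negbTE x0) /=.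
have s0 : 0 < ball_s a ^+ 2 by rewrite exprn_gt0// ball_s_gt0.
have : 0 < ball_s a ^+ 2 * (1 - vnormsq q) by rewrite mulr_gt0// subr_gt0.
rewrite !mulrBr => h1 n0 h2; rewrite -(ltr_pM2r n0) mul1r; lra.
Qed.

(** The last coordinates force $x=y$, and this nonzero factor cancels on the right. *)
Lemma homog_inj p q x y : x != 0 ->
  homog p *m x%:M = homog q *m y%:M -> p = q.
Proof.
move=> x0; rewrite /homog !mul_col_mx !mul1mx => /eq_col_mx[pq].
move=> /matrixP/(_ ord0 ord0); rewrite !mxE /= !mulr1n => xy.
rewrite -[p]mulmx1 -[q]mulmx1 -(@mulrV _ x) ?quat_unitE//.
by rewrite scalar_mxM !mulmxA pq xy.
Qed.

Lemma phi0 a : phi a 0 = a.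
Proof. by rewrite /phi !mulmx0 mxE !subr0 invr1 mulmx1. Qed.

(** Two applications of [homog_mx a] give [homog (phi a (phi a q))] up to the product of the
    denominators, while the square of the matrix is a positive real scalar. *)
Lemma phiK a q : qball R n a -> qball R n q -> phi a (phi a q) = q.
Proof.
move=> ha hq; have hp := phi_qball ha hq.
apply: (@homog_inj _ _
  ((1 - (adjmx a *m phi a q) ord0 ord0) * (1 - (adjmx a *m q) ord0 ord0))
  (realq (ball_s a ^+ 2))).
  by rewrite -quat_unitE unitrMr ?quat_unitE ?phi_denom_neq0.
rewrite scalar_mxM mulmxA -homog_phi// -mulmxA -homog_phi// mulmxA.
by rewrite homog_mx_sqr// mul_scalar_mx mulmx_realq.
Qed.

Lemma phi_self a : qball R n a -> phi a a = 0.
Proof. by move=> ha; rewrite -{2}[a]phi0 phiK//; exact: qball0. Qed.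

(** * The action of Sp(n)Sp(1), its commutation with [phi], and the composition law *)

Lemma Sp_adjmxK U : Sp R n U -> adjmx U *m U = 1%:M.
Proof. by move=> hU; apply: quat_mulmx1C. Qed.

Lemma Sp_adjmx U : Sp R n U -> Sp R n (adjmx U).
Proof. by move=> hU; rewrite /Sp /mkset adjmxK Sp_adjmxK. Qed.

Lemma Sp_mul U V : Sp R n U -> Sp R n V -> Sp R n (U *m V).
Proof.
rewrite /Sp /mkset => hU hV.
by rewrite adjmxM mulmxA -(mulmxA U) hV mulmx1.
Qed.

Lemma spactM U V x y q : spact U x (spact V y q) = spact (U *m V) (x * y) q.
Proof. by rewrite /spact conjq_mul scalar_mxM !mulmxA. Qed.

Lemma spact1 q : spact 1%:M 1 q = q.
Proof. by rewrite /spact mul1mx conjq1 mulmx1. Qed.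

Lemma spactK U x q : Sp R n U -> unitq R x ->
  spact U x (spact (adjmx U) (conjq x) q) = q.
Proof.
by move=> hU hx; rewrite spactM (hU : _ *m _ = _) unitq_mulqV// spact1.
Qed.

Lemma spactVK U x q : Sp R n U -> unitq R x ->
  spact (adjmx U) (conjq x) (spact U x q) = q.
Proof. by move=> hU hx; rewrite spactM Sp_adjmxK// unitq_mulVq// spact1. Qed.

(** The factor $U$ cancels, but the right factor [conjq x] survives on both sides of the scalar
    $p^*q$. *)
Lemma adjmx_spact_mul U x p q : Sp R n U ->
  adjmx (spact U x p) *m spact U x q
    = (x * (adjmx p *m q) ord0 ord0 * conjq x)%:M.
Proof.
move=> hU; rewrite /spact !adjmxM adjmx_scalar conjqK -!mulmxA.
rewrite (mulmxA _ U) Sp_adjmxK// mul1mx (mulmxA (adjmx p)).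
by rewrite {1}[adjmx p *m q]mx11_scalar -!scalar_mxM mulrA.
Qed.

Lemma vnormsq_spact U x q : Sp R n U -> unitq R x ->
  vnormsq (spact U x q) = vnormsq q.
Proof.
move=> hU hx; rewrite /vnormsq adjmx_spact_mul// vnormsqE !mxE /= !mulr1n.
by rewrite -realqC -mulrA unitq_mulqV// mulr1.
Qed.

Lemma spact_qball U x q : Sp R n U -> unitq R x -> qball R n q ->
  qball R n (spact U x q).
Proof. by move=> hU hx /qballP hq; apply/qballP; rewrite vnormsq_spact. Qed.

Lemma ball_mx_spact U x a : Sp R n U -> unitq R x -> qball R n a ->
  ball_mx (spact U x a) = U *m ball_mx a *m adjmx U.
Proof.
move=> hU hx ha; have hb := spact_qball hU hx ha.
have sE : ball_s (spact U x a) = ball_s a.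
  by rewrite /ball_s !sqr_vnorm vnormsq_spact.
rewrite !ball_mxE// sE mulmxDr mulmxDl scale_realq_mulmx mulmx_realq.
rewrite -!scalemxAl (hU : _ *m _ = _) scalemx1; congr (_ *: _ + _).
rewrite /spact !adjmxM adjmx_scalar conjqK !mulmxA -(mulmxA (U *m a)).
by rewrite -scalar_mxM unitq_mulVq// mulmx1.
Qed.

(** The matrix of [phi] is conjugated by $U$ and its denominator $d$ by $x$. The inverse
    $xd^{-1}\bar x$ meets the $\bar x$ at the right of the numerator, and $\bar x x=1$ leaves the
    action on [phi a q]. *)
Lemma phi_spact U x a q : Sp R n U -> unitq R x -> qball R n a -> qball R n q ->
  phi (spact U x a) (spact U x q) = spact U x (phi a q).
Proof.
move=> hU hx ha hq; have d0 := phi_denom_neq0 ha hq.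
have xx := unitq_mulVq hx; have xx' := unitq_mulqV hx.
have ux : x \is a GRing.unit by apply/unitrP; exists (conjq x).
have xV : x^-1 = conjq x by rewrite -[LHS]mul1r -xx -mulrA mulrV// mulr1.
rewrite {1}/phi ball_mx_spact// adjmx_spact_mul// mxE /= mulr1n.
have -> : 1 - x * (adjmx a *m q) ord0 ord0 * conjq x
    = x * (1 - (adjmx a *m q) ord0 ord0) * conjq x.
  by rewrite mulrBr mulr1 mulrBl xx'.
rewrite -xV invrM ?unitrV//; last by rewrite unitrMr.
rewrite (invrM ux d0) invrK xV.
rewrite /spact /phi -!mulmxA (mulmxA (adjmx U)) Sp_adjmxK// mul1mx.
rewrite !mulmxA -mulmxBl -!mulmxA -mulmxBr -!scalar_mxM.
by rewrite (mulrA _ x) xx mul1r mulmxA.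
Qed.

(** The last column of $T$ is $(0;x)$. Comparing blocks in the form identity gives $|x|^2=k$, then
    $\bar x z=0$, which kills the lower left block $z$, and finally $X^*X=kI$. *)
Lemma lorentz_stabilizer (k : R) (T : 'M[H]_(n + 1)) x :
    0 < k -> adjmx T *m J *m T = realq k *: J ->
    T *m homog 0 = homog 0 *m x%:M ->
  exists U (q0 : H), [/\ Sp R n U, unitq R q0 &
    forall q, T *m homog q = homog (spact U q0 q) *m x%:M].
Proof.
move=> k0; rewrite -[T]submxK.
set X := ulsubmx T; set y := ursubmx T; set z := dlsubmx T; set w := drsubmx T.
move=> TJ; rewrite /homog mul_block_col mul_col_mx !mulmx0 !add0r !mulmx1.
rewrite mul0mx mul1mx => /eq_col_mx[y0 wx].
move: TJ; rewrite y0 wx adjmx_block /J !mulmx_block scale_block_mx.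
rewrite !mulmx0 !mulmxN !mulmx1 adjmx0 !(addr0, add0r, mul0mx) !mulNmx.
rewrite !scaler0 scalerN adjmx_scalar.
case/eq_block_mx => XX _ zx xx.
have nx : normsqq x = k.
  move/matrixP/(_ ord0 ord0): xx; rewrite -scalar_mxM conjqM scalemx1 !mxE /=.
  by rewrite !mulr1n => /oppr_inj/realq_inj.
have x0 : x != 0 by rewrite -normsqq_eq0 nx gt_eqF.
have z0 : z = 0.
  move/eqP: zx; rewrite oppr_eq0 => /eqP zx.
  have ux : conjq x \is a GRing.unit.
    by rewrite quat_unitE -normsqq_eq0 normsqq_conj normsqq_eq0.
  by rewrite -[z]mul1mx -(mulVr ux) scalar_mxM -mulmxA zx mulmx0.
move: XX; rewrite z0 mulmx0 oppr0 addr0 scalemx1 => XX.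
set r := Num.sqrt k.
have r0 : r != 0 by rewrite gt_eqF// sqrtr_gt0.
have rr : r ^+ 2 = k by rewrite sqr_sqrtr// ltW.
have rk : r^-1 * (r^-1 * k) = 1 by rewrite -rr; field.
(* Dividing both $X$ and $x$ by $\sqrt k$ normalizes them. The two factors $1/\sqrt k$ combine to
   $\bar x/k=x^{-1}$, as required by $(Xq;x)=(Xqx^{-1};1)x$. *)
exists (realq r^-1 *: X), (realq r^-1 * x); split.
- apply: quat_mulmx1C; rewrite adjmxZ_real -scalemxAl scale_realq_mulmx XX.
  by rewrite !scale_scalar_mx -!realqM rk.
- by apply/unitqP; rewrite normsqqM normsqq_real nx expr2 -mulrA.
move=> q; rewrite mul_block_col !mulmx1 mul0mx !(addr0, add0r) mul_col_mx mul1mx.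
congr col_mx; rewrite /spact -mulmxA -scalar_mxM conjq_mul conjq_real.
rewrite -realqC -mulrA conjqM nx -realqM mulmx_realq -!scalemxAl scalerA -realqM.
by rewrite mulrAC -mulrA rk realq1 scale1r.
Qed.

Lemma phi_comp a b : qball R n a -> qball R n b ->
  exists U (q0 : H), [/\ Sp R n U, unitq R q0 &
    forall q, qball R n q -> phi a (phi b q) = spact U q0 (phi (phi b a) q)].
Proof.
move=> ha hb; have hc := phi_qball hb ha; set c := phi b a in hc *.
have act q : qball R n q -> exists2 x, x != 0 &
    homog_mx a *m homog_mx b *m homog_mx c *m homog q
      = homog (phi a (phi b (phi c q))) *m x%:M.
  move=> hq; have hcq := phi_qball hc hq; have hbq := phi_qball hb hcq.
  exists ((1 - (adjmx a *m phi b (phi c q)) ord0 ord0)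
          * ((1 - (adjmx b *m phi c q) ord0 ord0)
             * (1 - (adjmx c *m q) ord0 ord0))).
    by rewrite -quat_unitE unitrMr ?unitrMr ?quat_unitE ?phi_denom_neq0.
  rewrite -!mulmxA (homog_phi hc hq) [homog_mx b *m _]mulmxA (homog_phi hb hcq).
  rewrite 2![homog_mx a *m _]mulmxA (homog_phi ha hbq).
  by rewrite !scalar_mxM -!mulmxA.
have [x0 x0_neq0] := act 0 (qball0).
(* The origin is fixed: [phi c] sends it to [phi b a], [phi b] sends this back to [a], and [phi a]
   sends [a] to the origin. *)
rewrite phi0 phiK// phi_self// => act0.
have similT := lorentz_similM (lorentz_similM (homog_mx_form ha)
  (homog_mx_form hb)) (homog_mx_form hc).
have [|U [q0 [hU hq0 actU]]] := lorentz_stabilizer _ similT act0.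
  by rewrite !mulr_gt0 ?exprn_gt0 ?ball_s_gt0.
exists U, q0; split=> // q hq; have hcq := phi_qball hc hq.
(* The triple composite is now known to act linearly; evaluating it at [phi c q] removes [phi c], an
   involution. *)
rewrite -{1}[q](phiK hc hq).
have [y y0] := act _ hcq; rewrite actU => /esym.
exact: homog_inj.
Qed.

End BallMaps.

Theorem theorem2p1 (R : realType) (n : nat) (hn : (0 < n)%N) :
  [/\ forall a b : 'cV[quat R]_n, qball R n a -> qball R n b ->
        exists (U : 'M[quat R]_n) (q0 : quat R),
          [/\ Sp R n U, unitq R q0
            & {in qball R n, phi a \o phi b =1 spact U q0 \o phi (phi b a)}],
      forall (a : 'cV[quat R]_n) (U1 : 'M[quat R]_n) (q1 : quat R),
        qball R n a -> Sp R n U1 -> unitq R q1 ->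
        exists (b : 'cV[quat R]_n) (U2 : 'M[quat R]_n) (q2 : quat R),
          [/\ qball R n b, Sp R n U2, unitq R q2
            & {in qball R n, phi a \o spact U1 q1 =1 spact U2 q2 \o phi b}]
    & map_group_on (qball R n) (Gball R n)].
Proof.
have phi_spactr a U x q : Sp R n U -> unitq R x -> qball R n a ->
    qball R n q ->
    phi a (spact U x q) = spact U x (phi (spact (adjmx U) (conjq x) a) q).
  move=> hU hx ha hq; rewrite -phi_spact ?spactK//.
  by apply: spact_qball => //; [exact: Sp_adjmx|exact: unitq_conj].
have back U x a : Sp R n U -> unitq R x -> qball R n a ->
    qball R n (spact (adjmx U) (conjq x) a).
  by move=> hU hx; apply: spact_qball; [exact: Sp_adjmx|exact: unitq_conj].
split.
- move=> a b ha hb; have [U [q0 [hU hq0 E]]] := phi_comp ha hb.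
  by exists U, q0; split=> // q; rewrite inE; exact: E.
- move=> a U x ha hU hx.
  exists (spact (adjmx U) (conjq x) a), U, x; split=> //; first exact: back.
  by move=> q; rewrite inE; exact: phi_spactr.
split.
- move=> _ [U [x [a [hU hx ha ->]]]] q hq /=.
  by apply: spact_qball => //; exact: phi_qball.
- move=> _ _ [U [x [a [hU hx ha ->]]]] [V [y [b [hV hy hb ->]]]].
  (* Moving $(V,y)$ to the left past [phi a] replaces $a$ by its preimage under $(V,y)$; the
     composition law with [phi b] then contributes $(W,z)$. *)
  have ha' := back _ _ _ hV hy ha.
  have [W [z [hW hz E]]] := phi_comp ha' hb.
  set c := phi b (spact (adjmx V) (conjq y) a) in E.
  exists (spact (U *m (V *m W)) (x * (y * z)) \o phi c).
    exists (U *m (V *m W)), (x * (y * z)), c.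
    by split=> //; [do 2 apply: Sp_mul => // | do 2 apply: unitq_mul => //
                   | exact: phi_qball].
  move=> q; rewrite inE => hq /=; rewrite phi_spactr//; last exact: phi_qball.
  by rewrite E// !spactM mulmxA mulrA.
(* At the origin $A=I$, so [phi 0] is $q\mapsto-q$, and the identity needs the compensating sign
   $-I$. *)
- exists (spact (- 1%:M) 1 \o phi 0).
    exists (- 1%:M), 1, 0; split=> //; last exact: qball0.
      by rewrite /Sp /mkset raddfN /= adjmx_scalar conjq1 mulmxN mulmx1 opprK.
    by apply/unitqP; rewrite -realq1 normsqq_real expr1n.
  move=> q; rewrite inE => hq /=.
  rewrite /phi /spact /ball_mx eqxx mul1mx /adjmx raddf0 map_mx0 mul0mx mxE.
  by rewrite sub0r subr0 invr1 conjq1 !mulmx1 mulmxN mulNmx mul1mx opprK.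
- move=> _ [U [x [a [hU hx ha ->]]]].
  have hU' := Sp_adjmx hU; have hx' := unitq_conj hx.
  (* The inverse is [phi a] after the inverse of $(U,x)$; bringing the linear factor to the left
     replaces $a$ by its image under $(U,x)$. *)
  exists (spact (adjmx U) (conjq x) \o phi (spact U x a)); split.
  + exists (adjmx U), (conjq x), (spact U x a); split=> //.
    exact: spact_qball.
  + move=> q; rewrite inE => hq /=.
    by rewrite phi_spact ?spactVK ?phiK//; exact: phi_qball.
  + move=> q; rewrite inE => hq /=.
    have hb := spact_qball hU hx ha.
    rewrite -{1}[a](spactVK a hU hx) phi_spact ?spactK ?phiK//.
    exact: phi_qball.
Qed.
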